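(* Let $(V,\omega,\mu)$ be a connected, locally finite weighted graph on a countably infinite set $V$, let $\sigma>1$, let $v:V\to(0,\infty)$, and let $w:V\to\mathbb R$. Assume the following. (1) There exists a function $H:V\to(0,\infty)$ such that $\Delta H(x)+w(x)H(x)=0$ for every $x\in V$. (2) For this $H$, there exist constants $\gamma>0$, $R_0>0$, $C>0$, a family of finitely supported functions $\varphi_R:V\to[0,1]$, $R\ge R_0$ (with $R$ real), and a family of subsets $E_R\subset V$, $R\ge R_0$, such that $$\lim_{R\to\infty}\varphi_R(x)=1\qquad\text{for every }x\in V,$$ and $$(-\Delta_H\varphi_R)^+(x)\le \frac{C}{R^\gamma}\,\mathbf 1_{E_R}(x)\qquad\text{for all }x\in V,\ R\ge R_0.$$ (3) For every finite set $K\subset V$ there exists $R_K>0$ such that $E_R\cap K=\varnothing$ for all $R\ge R_K$ (with $R\ge R_0$). (4) With the same $H$, $\gamma$ and $E_R$, $$\sum_{x\in E_R}\mu(x)H(x)v(x)^{-\frac{1}{\sigma-1}}=O\left(R^{\frac{\gamma\sigma}{\sigma-1}}\right)\qquad\text{as }R\to\infty.$$ Then the only nonnegative solution of $$\Delta u+w(x)u+v(x)u^\sigma\le 0\qquad\text{in }V$$ is $u\equiv 0$; that is, if $u:V\to[0,\infty)$ satisfies $\Delta u(x)+w(x)u(x)+v(x)u(x)^\sigma\le 0$ for every $x\in V$, then $u(x)=0$ for every $x\in V$.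
   Context: Weighted graph: $V$ is a countably infinite set; a weighted graph on $V$ is a triple $(V,\omega,\mu)$ where $\omega:V\times V\to[0,\infty)$ satisfies $\omega_{xy}=\omega_{yx}$ and $\omega_{xx}=0$ for all $x,y\in V$, and $\mu:V\to(0,\infty)$. Two distinct vertices $x,y$ are adjacent, written $x\sim y$, if $\omega_{xy}>0$. The graph is connected if any two vertices $x,y$ can be joined by a path, i.e. a finite sequence $x=x_0,x_1,\ldots,x_m=y$ with $x_{i-1}\sim x_i$ for $i=1,\ldots,m$. It is locally finite if for every $x\in V$ the set $\{y\in V: y\sim x\}$ is finite. Laplacian: for $f:V\to\mathbb R$, $$\Delta f(x)=\frac{1}{\mu(x)}\sum_{y\sim x}\omega_{xy}\bigl(f(y)-f(x)\bigr),\qquad x\in V.$$ $H$-Laplacian: for $H:V\to(0,\infty)$ and $f:V\to\mathbb R$, $$\Delta_H f(x)=\frac{1}{H(x)^2\mu(x)}\sum_{y\sim x}\omega_{xy}H(x)H(y)\bigl(f(y)-f(x)\bigr),\qquad x\in V,$$ i.e. $\Delta_H$ is the graph Laplacian of the weighted graph with edge weights $\omega^H_{xy}=H(x)H(y)\omega_{xy}$ and vertex measure $\mu_H(x)=H(x)^2\mu(x)$. Notation: $f^+(x)=\max\{f(x),0\}$ denotes the positive part; $\mathbf 1_E$ is the indicator function of $E\subset V$; $f$ has finite support if $\{x\in V: f(x)\neq 0\}$ is finite. The sum in (4) is a sum of positive terms with values in $[0,\infty]$; the $O(\cdot)$ condition means that there are constants $C',R_1>0$ such that the sum is at most $C'R^{\gamma\sigma/(\sigma-1)}$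 for all $R\ge R_1$. *)

(* Defs.v *)
From mathcomp Require Export all_boot all_order all_algebra.
From mathcomp Require Export all_classical all_reals all_analysis.
Export Order.TTheory GRing.Theory Num.Theory.
Export numFieldNormedType.Exports.

Set Implicit Arguments.
Unset Strict Implicit.
Unset Printing Implicit Defensive.

Local Open Scope classical_set_scope.
Local Open Scope ring_scope.

Record weighted_graph (R : realType) (V : choiceType) := WeightedGraph {
  weight : V -> V -> R ;
  vmeasure : V -> R ;
  weight_ge0 : forall x y, 0 <= weight x y ;
  weight_sym : forall x y, weight x y = weight y x ;
  weight_diag : forall x, weight x x = 0 ;
  vmeasure_gt0 : forall x, 0 < vmeasure x
}.

Section WeightedGraphDefs.
Context {R : realType} {V : choiceType}.
Variable G : weighted_graph R V.

(* Adjacent vertices are automatically distinct, by [weight_diag]. *)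
Definition adj : rel V := fun x y => 0 < weight G x y.

Definition nbhd (x : V) : set V := [set y | adj x y].

Definition graph_connected : Prop :=
  forall x y : V, exists p : seq V, path adj x p /\ last x p = y.

Definition locally_finite_graph : Prop :=
  forall x : V, finite_set (nbhd x).

(* The sums below range over a set; such a sum is by convention 0 when
   infinitely many terms are nonzero, which local finiteness excludes. *)
Definition laplacian (f : V -> R) (x : V) : R :=
  (vmeasure G x)^-1 * \sum_(y \in nbhd x) weight G x y * (f y - f x).

Definition hlaplacian (H f : V -> R) (x : V) : R :=
  (H x ^+ 2 * vmeasure G x)^-1 *
    \sum_(y \in nbhd x) weight G x y * H x * H y * (f y - f x).

End WeightedGraphDefs.

(* Main.v *)
(* Put s = sigma / (sigma - 1) and test the inequality against H phi_R^s.  As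
   H solves the linear equation, Green's formula moves the operator onto
   phi_R^s as Delta_H, and convexity gives
   -Delta_H phi^s <= s phi^(s-1) (-Delta_H phi)^+.  Young's inequality with a
   free parameter l, combined with the growth condition, then yields
     I_R <= s l J_R + D l^(-1/(sigma-1)),
   where I_R = sum mu H v u^sigma phi_R^s and J_R is the same sum over E_R.
   A small l bounds I_R, so sum mu H v u^sigma is finite; since E_R leaves
   every finite set, J_R is a tail of a convergent series and tends to 0, and a
   large l then forces the whole sum to vanish. *)
Require Import Defs.
From mathcomp Require Import ring lra.

Set Implicit Arguments.
Unset Strict Implicit.
Unset Printing Implicit Defensive.

Local Open Scope classical_set_scope.
Local Open Scope ring_scope.

(** * Two inequalities for real powers *)

(** Convexity of the power function, obtained without derivatives: this is [p] times Young's
    inequality for [b] and [a ^ (p - 1)] with exponents [p] and [p / (p - 1)]. *)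
Lemma powR_tangent_le (R : realType) (p a b : R) : 1 < p -> 0 <= a -> 0 <= b ->
  p * a `^ (p - 1) * (b - a) <= b `^ p - a `^ p.
Proof.
move=> p1 a0 b0; have p0 : 0 < p by lra.
have pN0 : p != 0 by rewrite gt_eqF.
have p10 : p - 1 != 0 by rewrite subr_eq0 gt_eqF.
have q0 : 0 < p / (p - 1) by rewrite divr_gt0// subr_gt0.
have := conjugate_powR b0 (powR_ge0 a (p - 1)) p0 q0.
have -> : p^-1 + (p / (p - 1))^-1 = 1 by field; apply/andP.
move=> /(_ erefl).
rewrite -powRrM mulrC mulrCA divff// mulr1 invf_div.
move=> /(ler_wpM2l (ltW p0)).
have -> : p * (b `^ p / p + a `^ p * ((p - 1) / p)) =
    b `^ p + p * a `^ p - a `^ p by field.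
rewrite -(mulr_powRB1 a0 p0); lra.
Qed.

(** One of the two terms always suffices: the first if [q <= l * a ^ (p - 1)], and otherwise the
    second, because then [a] is below [(q / l) ^ (1 / (p - 1))]. *)
Lemma young_powR_le (R : realType) (p l a q : R) :
  1 < p -> 0 < l -> 0 <= a -> 0 <= q ->
  a * q <= l * a `^ p + l `^ (- (1 / (p - 1))) * q `^ (p / (p - 1)).
Proof.
move=> p1 l0 a0 q0; have p0 : 0 < p by lra.
have p10 : p - 1 != 0 by rewrite subr_eq0 gt_eqF.
have s0 : 0 < p / (p - 1) by rewrite divr_gt0// subr_gt0.
have t0 : 0 < 1 / (p - 1) by rewrite divr_gt0// subr_gt0.
have [ql|lq] := leP q (l * a `^ (p - 1)).
  rewrite ler_wpDr ?mulr_ge0 ?powR_ge0//.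
  by rewrite -(mulr_powRB1 a0 p0) mulrCA ler_wpM2l.
rewrite ler_wpDl ?mulr_ge0 ?powR_ge0 ?(ltW l0)//.
rewrite -(mulr_powRB1 q0 s0).
have -> : p / (p - 1) - 1 = 1 / (p - 1) by field.
rewrite mulrCA [a * q]mulrC ler_wpM2l// powRN mulrC.
have -> : a = (a `^ (p - 1)) `^ (1 / (p - 1)).
  by rewrite -powRrM mul1r divff// powRr1.
rewrite ler_pdivlMr ?powR_gt0// -powRM ?powR_ge0 ?(ltW l0)//.
rewrite ge0_ler_powR ?(ltW t0)// ?nnegrE ?mulr_ge0 ?powR_ge0 ?(ltW l0)//.
by rewrite mulrC ltW.
Qed.

(** * Finite sums and Green's formula *)

Lemma ler_sum_subseq (R : realType) (V : choiceType) (g : V -> R)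
    (P : pred V) (K F : seq V) :
  uniq K -> uniq F -> {subset K <= F} -> {in K, forall x, P x} ->
  (forall x, 0 <= g x) ->
  \sum_(x <- K) g x <= \sum_(x <- F | P x) g x.
Proof.
move=> uK uF KF KP g0.
have perm_K : perm_eq K [seq x <- F | (x \in K) && P x].
  apply: uniq_perm => //; first exact: filter_uniq.
  move=> x; rewrite mem_filter; case: (boolP (x \in K)) => //= xK.
  by rewrite KP// KF.
rewrite (perm_big _ perm_K) big_filter big_mkcond [leRHS]big_mkcond/=.
by apply: ler_sum => x _; case: (x \in K); case: (P x) => /=.
Qed.

(** Non-neighbours carry weight 0. Summing over one list [F] for every [x] is what later permits
    exchanging the two summations. *)
Lemma sum_nbhd (R : realType) (V : choiceType) (G : weighted_graph R V)
    (F : seq V) (x : V) (h : V -> R) :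
  locally_finite_graph G -> uniq F ->
  (forall y, nbhd G x y -> y \notin F -> h y = 0) ->
  \sum_(y \in nbhd G x) weight G x y * h y = \sum_(y <- F) weight G x y * h y.
Proof.
move=> lf uF h0; rewrite [RHS]fsbig_seq// [LHS]fsbig_mkcond [RHS]fsbig_mkcond.
apply: eq_fsbigr => y _; rewrite /patch.
have [/set_mem yN|yN] := boolP (y \in nbhd G x);
  have [/set_mem yF|yF] := boolP (y \in [set` F]) => //.
- by rewrite h0 ?mulr0//; apply: contraNN yF => yF; rewrite inE.
- suff -> : weight G x y = 0 by rewrite mul0r.
  apply/eqP; rewrite eq_le weight_ge0 andbT leNgt.
  by apply: contraNN yN => xy; rewrite inE.
Qed.

(** Since [Delta u + w u = H Delta_H (u / H)], this is Green's formula for [psi] and [u / H] with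
    vertex measure [H^2 mu]. Both sides become double sums over [F] that agree after exchanging [x]
    and [y] in one term, by symmetry of the weight. *)
Lemma ground_state_green (R : realType) (V : choiceType)
    (G : weighted_graph R V) (H w u psi : V -> R) (F : seq V) :
  locally_finite_graph G -> (forall x, 0 < H x) ->
  (forall x, laplacian G H x + w x * H x = 0) ->
  uniq F ->
  (forall x, psi x != 0 -> x \in F) ->
  (forall x y, psi x != 0 -> nbhd G x y -> y \in F) ->
  \sum_(x <- F) vmeasure G x * H x * psi x * (laplacian G u x + w x * u x) =
  \sum_(x <- F) vmeasure G x * H x * u x * hlaplacian G H psi x.
Proof.
move=> lf H0 Heq uF sF nF.
pose S x y := weight G x y * (psi x * (H x * u y - u x * H y)).
(* [H] solves the linear equation, so [w u = - (Delta H / H) u] and the potential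
   cancels against the diagonal part of [Delta u]. *)
have left_sum x : vmeasure G x * H x * psi x * (laplacian G u x + w x * u x) =
    \sum_(y <- F) S x y.
  have [p0|pN0] := eqVneq (psi x) 0.
    rewrite p0 mulr0 mul0r big1// => y _.
    by rewrite /S p0 mul0r mulr0.
  have hF (h : V -> R) : \sum_(y \in nbhd G x) weight G x y * h y =
      \sum_(y <- F) weight G x y * h y.
    by apply: sum_nbhd => // y xy /negP[]; exact: nF xy.
  have mN0 : vmeasure G x != 0 by rewrite gt_eqF ?vmeasure_gt0.
  have HN0 : H x != 0 by rewrite gt_eqF.
  have -> : w x * u x = - laplacian G H x / H x * u x.
    by have := Heq x => /eqP; rewrite addrC addr_eq0 => /eqP <-; rewrite mulfK.
  rewrite /laplacian !hF.
  transitivity (\sum_(y <- F) (H x * psi x * (weight G x y * (u y - u x))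
      - psi x * u x * (weight G x y * (H y - H x)))).
    by rewrite sumrB -!mulr_sumr; field; apply/andP.
  by apply: eq_bigr => y _; rewrite /S; ring.
have right_sum x : vmeasure G x * H x * u x * hlaplacian G H psi x =
    \sum_(y <- F) u x * (weight G x y * (H y * (psi y - psi x))).
  have mN0 : vmeasure G x != 0 by rewrite gt_eqF ?vmeasure_gt0.
  have HN0 : H x != 0 by rewrite gt_eqF.
  (* One factor [H x] cancels, which leaves a sum of the shape [weight * h] that [sum_nbhd]
     handles. *)
  have -> : hlaplacian G H psi x = (H x * vmeasure G x)^-1 *
      \sum_(y \in nbhd G x) weight G x y * (H y * (psi y - psi x)).
    rewrite /hlaplacian.
    under eq_fsbigr do rewrite mulrAC -mulrA [_ * H x]mulrC -!mulrA.
    rewrite -mulr_fsumr.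
    under eq_fsbigr do rewrite [(psi _ - _) * _]mulrC.
    by field; apply/andP.
  rewrite (sum_nbhd (F := F))//.
    by rewrite -mulr_sumr; field; apply/andP.
  move=> y xy yF.
  have -> : psi y = 0 by apply/eqP; apply: contraNT yF; exact: sF.
  have -> : psi x = 0 by apply/eqP; apply: contraNT yF => px; exact: nF px xy.
  by rewrite subr0 mulr0.
under eq_bigr do rewrite left_sum.
under [RHS]eq_bigr do rewrite right_sum.
transitivity (\sum_(x <- F) \sum_(y <- F)
    (weight G x y * psi x * H x * u y - weight G x y * psi x * u x * H y)).
  by apply: eq_bigr => x _; apply: eq_bigr => y _; rewrite /S; ring.
transitivity (\sum_(x <- F) \sum_(y <- F)
    (weight G x y * psi y * H y * u x - weight G x y * psi x * u x * H y)).
  under eq_bigr do rewrite sumrB.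
  under [RHS]eq_bigr do rewrite sumrB.
  rewrite !sumrB exchange_big/=; congr (_ - _).
  by apply: eq_bigr => x _; apply: eq_bigr => y _; rewrite weight_sym.
by apply: eq_bigr => x _; apply: eq_bigr => y _; ring.
Qed.

(** * Energy estimate for a single test function *)

(** The tangent inequality holds term by term, and all weights are nonnegative. *)
Lemma hlaplacian_powR_ge (R : realType) (V : choiceType)
    (G : weighted_graph R V) (H phi : V -> R) (s : R) (x : V) :
  locally_finite_graph G -> (forall x, 0 < H x) -> (forall x, 0 <= phi x) ->
  1 < s ->
  s * phi x `^ (s - 1) * hlaplacian G H phi x <=
    hlaplacian G H (fun y => phi y `^ s) x.
Proof.
move=> lf H0 phi0 s1; rewrite /hlaplacian mulrCA ler_wpM2l//.
  by rewrite invr_ge0 mulr_ge0 ?exprn_ge0 ?ltW ?vmeasure_gt0.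
rewrite mulr_fsumr !fsbig_finite//=; do ?exact: lf.
apply: ler_sum => y _; rewrite mulrCA ler_wpM2l ?powR_tangent_le//.
by rewrite !mulr_ge0 ?weight_ge0 ?ltW.
Qed.

(** The list [L] is arbitrary so that the finite range [F] can be made to contain any prescribed
    vertices; [E] may be infinite and enters only through [F]. *)
Lemma weighted_energy_le (R : realType) (V : choiceType)
    (G : weighted_graph R V) (H v w u phi : V -> R) (E : set V)
    (sigma k l : R) (L : seq V) :
  locally_finite_graph G -> 1 < sigma -> (forall x, 0 < v x) ->
  (forall x, 0 < H x) -> (forall x, laplacian G H x + w x * H x = 0) ->
  (forall x, 0 <= u x) ->
  (forall x, laplacian G u x + w x * u x + v x * u x `^ sigma <= 0) ->
  (forall x, 0 <= phi x) -> finite_set [set x | phi x != 0] ->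
  0 <= k ->
  (forall x, - hlaplacian G H phi x <= k * \1_E x) ->
  0 < l ->
  let s := sigma / (sigma - 1) in
  let t := 1 / (sigma - 1) in
  let g x := vmeasure G x * H x * v x * u x `^ sigma in
  exists F, [/\ uniq F, {subset L <= F} &
    \sum_(x <- F) g x * phi x `^ s <=
      s * (l * \sum_(x <- F | x \in E) g x * phi x `^ s +
        l `^ (- t) * k `^ s *
        \sum_(x <- F | x \in E) vmeasure G x * H x * v x `^ (- t))].
Proof.
move=> lf sig1 v0 H0 Heq u0 usol phi0 phifin k0 philap l0 s t g.
have sig0 : 0 < sigma by lra.
have sigN0 : sigma - 1 != 0 by rewrite subr_eq0 gt_eqF.
have t0 : 0 < t by rewrite divr_gt0// subr_gt0.
have st : s - 1 = t by rewrite /s /t; field.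
have tsig : t * sigma = s by rewrite /t /s; field.
have s1 : 1 < s by lra.
have mu0 := vmeasure_gt0 G.
pose A := finmap.enum_fset (fset_set [set x | phi x != 0]).
(* All neighbours of the support, so that Green's formula has no boundary term. *)
pose F := undup (L ++ A ++ flatten [seq finmap.enum_fset (fset_set (nbhd G x)) | x <- A]).
(* Positivity of [s] matters here, since [powR] sets 0 to the power 0 equal to 1. *)
have supp x : phi x `^ s != 0 -> x \in A.
  move=> px; rewrite [_ \in _]in_fset_set// inE/=.
  by apply: contraNN px => /eqP ->; rewrite powR0// gt_eqF//; lra.
exists F; split; first exact: undup_uniq.
  by move=> x xL; rewrite mem_undup mem_cat xL.
have := @ground_state_green _ _ G H w u (fun x => phi x `^ s) F lf H0 Heq
  (undup_uniq _).
move=> green.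
apply: (@le_trans _ _
    (\sum_(x <- F) - (vmeasure G x * H x * u x *
       hlaplacian G H (fun y => phi y `^ s) x))).
  rewrite sumrN -green.
  - rewrite -sumrN; apply: ler_sum => x _.
    rewrite -mulrN.
    have -> : g x * phi x `^ s =
        vmeasure G x * H x * phi x `^ s * (v x * u x `^ sigma).
      by rewrite /g; ring.
    apply: ler_wpM2l; first by rewrite !mulr_ge0 ?powR_ge0 ?ltW.
    by have := usol x; lra.
  - by move=> x /supp xA; rewrite mem_undup !mem_cat xA orbT.
  - move=> x y /supp xA xy; rewrite mem_undup !mem_cat; apply/orP; right.
    apply/orP; right; apply/flatten_mapP; exists x => //.
    by rewrite [_ \in _]in_fset_set ?inE//; exact: lf.
rewrite !mulr_sumr -big_split/= mulr_sumr [leRHS]big_mkcond/=.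
apply: ler_sum => x _.
have mH0 : 0 <= vmeasure G x * H x by rewrite mulr_ge0 ?ltW.
rewrite -mulrN -[_ * u x * _]mulrA.
have step1 : - hlaplacian G H (fun y => phi y `^ s) x <=
    s * phi x `^ t * (k * \1_E x).
  have h := hlaplacian_powR_ge x lf H0 phi0 s1.
  apply: (@le_trans _ _ (s * phi x `^ t * - hlaplacian G H phi x)).
    by rewrite -st mulrN lerN2.
  by rewrite ler_wpM2l ?philap// mulr_ge0 ?powR_ge0//; lra.
apply: (@le_trans _ _
    (vmeasure G x * H x * (u x * (s * phi x `^ t * (k * \1_E x))))).
  by rewrite !ler_wpM2l.
rewrite indicE; case: (x \in E); last by rewrite !mulr0.
rewrite mulr1n mulr1.
(* The parameter is [l * v x], which produces the weight [v] in the energy and [v ^ (- t)] in the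
   remainder; [t * sigma = s] restores the power [phi ^ s]. *)
have := young_powR_le sig1 (mulr_gt0 l0 (v0 x))
  (mulr_ge0 (u0 x) (powR_ge0 (phi x) t)) k0.
rewrite !powRM ?powR_ge0 ?(ltW l0) ?(ltW (v0 x))//.
rewrite -[(phi x `^ t) `^ sigma]powRrM tsig -/s -/t => young.
have := ler_wpM2l (mulr_ge0 (ltW (lt_trans ltr01 s1)) mH0) young.
by rewrite /g; congr (_ <= _); ring.
Qed.

(** * Absorption and vanishing of the total energy *)

(** The factor 1/2 makes [g] summable. The sum over [E r] is then a tail, so even a large factor [a]
    cannot prevent it from becoming small. A lower bound [c] for [psi] on finite lists replaces
    convergence to 1. *)
Lemma absorption_eq0 (R : realType) (V : choiceType) (g : V -> R)
    (psi : R -> V -> R) (E : R -> set V) (c : R) :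
  (forall x, 0 <= g x) -> 0 < c ->
  (\forall r \near +oo, forall x, 0 <= psi r x <= 1) ->
  (forall L : seq V, \forall r \near +oo, {in L, forall x, c <= psi r x}) ->
  (forall L : seq V, \forall r \near +oo, {in L, forall x, x \notin E r}) ->
  let absorbs a b := \forall r \near +oo, forall L : seq V,
    exists F, [/\ uniq F, {subset L <= F} &
      \sum_(x <- F) g x * psi r x <=
        a * \sum_(x <- F | x \in E r) g x * psi r x + b] in
  (exists b, absorbs 2^-1 b) ->
  (forall b, 0 < b -> exists2 a, 0 < a & absorbs a b) ->
  forall x, g x = 0.
Proof.
move=> g0 c0 psi01 psic Eesc absorbs [B absB] absb.
have gpsi r x : 0 <= psi r x <= 1 -> 0 <= g x * psi r x <= g x.
  by move=> /andP[? ?]; rewrite mulr_ge0//= ler_piMr.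
have bounded (L : seq V) : uniq L -> \sum_(x <- L) g x <= 2 * B / c.
  move=> uL.
  have [r [r01 rc rB]] : exists r, [/\ forall x, 0 <= psi r x <= 1,
      {in L, forall x, c <= psi r x} & forall L : seq V,
    exists F, [/\ uniq F, {subset L <= F} &
      \sum_(x <- F) g x * psi r x <=
        2^-1 * \sum_(x <- F | x \in E r) g x * psi r x + B]].
    apply: (@filter_ex _ (pinfty_nbhs R)).
    by apply: filterS3 psi01 (psic L) absB => r.
  have [F [uF LF FB]] := rB L.
  have g1 x : 0 <= g x * psi r x by have /andP[] := gpsi r x (r01 x).
  have LleF := ler_sum_subseq (P := predT) uL uF LF (fun _ _ => erefl) g1.
  have EleF : \sum_(x <- F | x \in E r) g x * psi r x <=
      \sum_(x <- F) g x * psi r x.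
    by rewrite big_mkcond; apply: ler_sum => x _; case: ifP.
  (* The part over [E r] is at most the whole sum, so half of it is absorbed on the left and the
     whole sum is at most [2 * B]. *)
  rewrite ler_pdivlMr// mulr_suml.
  apply: (@le_trans _ _ (\sum_(x <- L) g x * psi r x)).
    rewrite big_seq [leRHS]big_seq; apply: ler_sum => x xL.
    by rewrite ler_wpM2l// rc.
  by lra.
pose S := [set z | exists2 L : seq V, uniq L & z = \sum_(x <- L) g x].
have supS : has_sup S.
  split; first by exists 0, [::] => //; rewrite big_nil.
  by exists (2 * B / c) => z [L uL ->]; exact: bounded.
move=> x; apply/eqP; apply: contraT => gxN0.
have gx : 0 < g x by rewrite lt_neqAle eq_sym gxN0 g0.
(* The tail will contribute at most [a * (b / a) = b], so that [c * g x <= 2 * b], against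
   [c * g x = 4 * b]. *)
pose b := c * g x / 4.
have b0 : 0 < b by rewrite divr_gt0// mulr_gt0.
have [a a0 ab] := absb b b0.
have [_ [L uL ->] SL] := sup_adherent (divr_gt0 b0 a0) supS.
have [r [[r01 rc] rE rab]] : exists r, [/\ (forall x, 0 <= psi r x <= 1) /\
    {in [:: x], forall x, c <= psi r x}, {in L, forall x, x \notin E r} &
    forall L : seq V, exists F, [/\ uniq F, {subset L <= F} &
      \sum_(x <- F) g x * psi r x <=
        a * \sum_(x <- F | x \in E r) g x * psi r x + b]].
  apply: (@filter_ex _ (pinfty_nbhs R)).
  apply: filterS3 (filterI psi01 (psic [:: x])) (Eesc L) ab => r [? ?] ? ?.
  by split.
have [F [uF LF Fab]] := rab (x :: L).
have FS : \sum_(y <- F) g y <= sup S.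
  by apply: ub_le_sup; [case: supS | exists F].
(* [L] comes within [b / a] of the supremum and lies in [F] outside [E r], so less than [b / a]
   remains for [E r]. *)
have tail : \sum_(y <- F | y \in E r) g y * psi r y <= b / a.
  apply: (@le_trans _ _ (\sum_(y <- F | y \in E r) g y)).
    by apply: ler_sum => y _; have /andP[] := gpsi r y (r01 y).
  have := ler_sum_subseq (P := fun y => y \notin E r) uL uF
    (fun y yL => LF y (mem_behead (s := x :: L) yL)) rE g0.
  by move: FS; rewrite (bigID (fun y => y \in E r))/=; lra.
have xF : c * g x <= \sum_(y <- F) g y * psi r y.
  have g1 y : 0 <= g y * psi r y by have /andP[] := gpsi r y (r01 y).
  have xF : {subset [:: x] <= F}.
    by move=> y; rewrite inE => /eqP ->; rewrite LF ?mem_head.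
  have := ler_sum_subseq (P := predT) (K := [:: x]) erefl uF xF
    (fun _ _ => erefl) g1.
  rewrite big_seq1; apply: le_trans.
  by rewrite mulrC ler_wpM2l// rc ?mem_head.
have := ler_wpM2l (ltW a0) tail; rewrite mulrCA divff ?gt_eqF// mulr1.
have : c * g x = 4 * b by rewrite /b; field.
by lra.
Qed.

(** * Large radii and the choice of the parameter [l] *)

Lemma near_seq_forall (R : realType) (V : choiceType) (P : R -> V -> Prop) :
  (forall x, \forall r \near +oo, P r x) ->
  forall L : seq V, \forall r \near +oo, {in L, forall x, P r x}.
Proof.
move=> Px; elim=> [|x L IH]; first by apply: nearW => r y.
apply: filterS2 (Px x) IH => r Prx PrL y.
by rewrite inE => /predU1P[->|/PrL].
Qed.

Theorem theorem3p1 (R : realType) (V : choiceType)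
    (V_countable : countable [set: V]) (V_infinite : infinite_set [set: V])
    (G : weighted_graph R V)
    (G_connected : graph_connected G)
    (G_locally_finite : locally_finite_graph G)
    (sigma : R) (sigma_gt1 : 1 < sigma)
    (v : V -> R) (v_gt0 : forall x, 0 < v x)
    (w : V -> R)
    (H : V -> R) (H_gt0 : forall x, 0 < H x)
    (H_eq : forall x, laplacian G H x + w x * H x = 0)
    (gamma R0 C : R) (gamma_gt0 : 0 < gamma) (R0_gt0 : 0 < R0) (C_gt0 : 0 < C)
    (phi : R -> V -> R) (E : R -> set V)
    (phi_finsupp : forall r, R0 <= r -> finite_set [set x | phi r x != 0])
    (phi_01 : forall r, R0 <= r -> forall x, 0 <= phi r x <= 1)
    (phi_lim : forall x, phi r x @[r --> +oo] --> (1 : R))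
    (phi_lap : forall r, R0 <= r -> forall x,
      (fun y => - hlaplacian G H (phi r) y)^\+ x
        <= C / r `^ gamma * \1_(E r) x)
    (E_escapes : forall K : set V, finite_set K ->
      exists2 RK : R, 0 < RK &
        forall r, R0 <= r -> RK <= r -> E r `&` K = set0)
    (E_growth : exists C' R1 : R, [/\ 0 < C', 0 < R1 &
      forall r, R0 <= r -> R1 <= r ->
        (\esum_(x in E r)
            (vmeasure G x * H x * v x `^ (- (1 / (sigma - 1))))%:E
          <= (C' * r `^ (gamma * sigma / (sigma - 1)))%:E)%E]) :
  forall u : V -> R, (forall x, 0 <= u x) ->
    (forall x, laplacian G u x + w x * u x + v x * u x `^ sigma <= 0) ->
    forall x, u x = 0.
Proof.
move=> u u_ge0 u_sol.
have [C' [R1 [C'_gt0 R1_gt0 growth]]] := E_growth.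
pose s := sigma / (sigma - 1); pose t := 1 / (sigma - 1).
pose g x := vmeasure G x * H x * v x * u x `^ sigma.
pose D := s * C `^ s * C'.
have sigma1N0 : sigma - 1 != 0 by rewrite subr_eq0 gt_eqF.
have s_gt0 : 0 < s by rewrite divr_gt0 ?subr_gt0// (lt_trans ltr01).
have D_gt0 : 0 < D by apply: mulr_gt0 => //; rewrite mulr_gt0 ?powR_gt0.
have mHv_gt0 x : 0 < vmeasure G x * H x * v x.
  by rewrite !mulr_gt0 ?vmeasure_gt0.
have g_ge0 x : 0 <= g x by rewrite mulr_ge0 ?powR_ge0// ltW.
have growth_fin r (F : seq V) : R0 <= r -> R1 <= r -> uniq F ->
    \sum_(x <- F | x \in E r) vmeasure G x * H x * v x `^ (- t) <=
      C' * (r `^ gamma) `^ s.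
  move=> R0r R1r uF.
  rewrite -powRrM /s [gamma * _]mulrA -lee_fin.
  apply: le_trans (growth r R0r R1r); apply: esum_ge.
  exists [set` [seq x <- F | x \in E r]].
    split; first exact: finite_seq.
    by move=> x /=; rewrite mem_filter => /andP[/set_mem].
  rewrite -fsbig_seq ?filter_uniq// big_filter sumEFin.
  exact: lexx.
have energy l : 0 < l -> \forall r \near +oo, forall L : seq V,
    exists F, [/\ uniq F, {subset L <= F} &
      \sum_(x <- F) g x * phi r x `^ s <=
        s * l * \sum_(x <- F | x \in E r) g x * phi r x `^ s
          + D * l `^ (- t)].
  move=> l_gt0; near=> r => L.
  have R0r : R0 <= r by near: r; apply: nbhs_pinfty_ge; rewrite num_real.
  have R1r : R1 <= r by near: r; apply: nbhs_pinfty_ge; rewrite num_real.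
  have rg_gt0 : 0 < r `^ gamma by rewrite powR_gt0// (lt_le_trans R0_gt0).
  have k_ge0 : 0 <= C / r `^ gamma by rewrite divr_ge0 ?ltW.
  have phi_ge0 x : 0 <= phi r x by have /andP[] := phi_01 r R0r x.
  have phi_lap' x : - hlaplacian G H (phi r) x <= C / r `^ gamma * \1_(E r) x.
    apply: le_trans (phi_lap r R0r x).
    by rewrite /funrpos le_max lexx.
  have [F [uF LF FE]] := weighted_energy_le L G_locally_finite sigma_gt1 v_gt0
    H_gt0 H_eq u_ge0 u_sol phi_ge0 (phi_finsupp r R0r) k_ge0 phi_lap' l_gt0.
  exists F; split => //; apply: le_trans FE _.
  rewrite -/s -/t -/g mulrDr mulrA lerD2l.
  (* The powers of [r] from the Laplacian bound and from the growth condition cancel exactly, so [D]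
     does not depend on [r]. *)
  have -> : D * l `^ (- t) =
      s * (l `^ (- t) * (C / r `^ gamma) `^ s * (C' * (r `^ gamma) `^ s)).
    set x := r `^ gamma in rg_gt0 *.
    rewrite powRM ?invr_ge0 ?(ltW C_gt0) ?(ltW rg_gt0)//.
    rewrite -[x^-1]powR_inv1 ?(ltW rg_gt0)// -powRrM mulN1r !powRN.
    by rewrite /D; field; rewrite !gt_eqF// powR_gt0.
  by rewrite ler_wpM2l ?(ltW s_gt0)// ler_wpM2l ?mulr_ge0 ?powR_ge0// growth_fin.
have psi01 : \forall r \near +oo, forall x, 0 <= phi r x `^ s <= 1.
  near=> r => x; rewrite powR_ge0/=.
  have R0r : R0 <= r by near: r; apply: nbhs_pinfty_ge; rewrite num_real.
  have /andP[phi0 phi1] := phi_01 r R0r x.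
  have <- : 1 `^ s = 1 :> R by rewrite powR1.
  by rewrite ge0_ler_powR ?nnegrE ?(ltW s_gt0).
have psi_half x : \forall r \near +oo, 2^-1 `^ s <= phi r x `^ s.
  have : \forall r \near +oo, 2^-1 < phi r x.
    apply: (cvgr_gt 1 (phi_lim x)).
    by lra.
  apply: filterS => r half.
  have h0 : 0 <= 2^-1 :> R by lra.
  rewrite ge0_ler_powR ?nnegrE ?(ltW s_gt0)//; last exact: ltW.
  by rewrite (le_trans h0)// ltW.
have E_far x : \forall r \near +oo, x \notin E r.
  have [RK _ HK] := E_escapes _ (finite_set1 x).
  near=> r.
  have R0r : R0 <= r by near: r; apply: nbhs_pinfty_ge; rewrite num_real.
  have RKr : RK <= r by near: r; apply: nbhs_pinfty_ge; rewrite num_real.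
  apply/negP => /set_mem xE.
  by have : (E r `&` [set x]) x by []; rewrite HK.
have half_gt0 : 0 < 2^-1 `^ s :> R by rewrite powR_gt0// invr_gt0.
have g_eq0 : forall x, g x = 0.
  apply: (absorption_eq0 g_ge0 half_gt0 psi01 (near_seq_forall psi_half)
    (near_seq_forall E_far)).
  (* With [l = s^-1 / 2] the coefficient [s * l] is 1/2. *)
  - exists (D * (s^-1 / 2) `^ (- t)).
    have := energy (s^-1 / 2).
    rewrite mulrA divff ?gt_eqF// mul1r; apply.
    by rewrite divr_gt0// invr_gt0.
  (* This [l] solves [D * l ^ (- t) = b], because [t * (sigma - 1) = 1]. *)
  - move=> b b_gt0; pose l := (D / b) `^ (sigma - 1).
    have l_gt0 : 0 < l by rewrite powR_gt0// divr_gt0.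
    exists (s * l); first exact: mulr_gt0.
    have -> : b = D * l `^ (- t).
      rewrite /l -powRrM /t mul1r mulrN divff// powR_inv1 ?ltW ?divr_gt0//.
      by field; rewrite !gt_eqF.
    exact: energy.
move=> x; have /eqP := g_eq0 x.
by rewrite mulf_eq0 (gt_eqF (mHv_gt0 x))/= => /eqP/powR_eq0_eq0.
Unshelve. all: by end_near.
Qed.
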